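(* Let $G$ be a finite group. Then $\{K_g : g\in G\}=\{N^{\circ} : N\in N(G),\ N^{\circ}\neq\emptyset\}$, and this partition of $G$ is the finest normal superclass theory of $G$; that is, it is a normal superclass theory of $G$, and it refines every normal superclass theory of $G$.
   Context: Let $G$ be a finite group with identity $e$ (also written $1$), let $N(G)$ be the set of all normal subgroups of $G$, and let ${\rm Irr}(G)$ be the set of irreducible complex characters of $G$. For $g\in G$, $C_g$ is the conjugacy class of $g$. For $\chi\in{\rm Irr}(G)$ let $e_\chi=|G|^{-1}\chi(1)\sum_{g\in G}\chi(g^{-1})g\in\mathbb{C}[G]$ be the corresponding central idempotent. For $g\in G$ put $$E_g=\Big\{e_\chi : \chi\in{\rm Irr}(G),\ 1-\tfrac{\chi(g)}{\chi(1)}\neq 0\Big\},\qquad K_g=\bigcup_{h\in G,\ E_h=E_g}C_h.$$ For $N\in N(G)$ put $N^{\circ}=N\setminus\bigcup_{K\in N(G),\ K<N}K$, where $K<N$ means $K$ is a proper subgroup of $N$. Supercharacter theory: a pair $(\mathcal{X},\mathcal{K})$, where $\mathcal{X}$ is a partition of ${\rm Irr}(G)$ and $\mathcal{K}$ is a partition of $G$ (into nonempty parts), such that (a) $|\mathcal{X}|=|\mathcal{K}|$; (b) for each $X\in\mathcal{X}$ there is a nonzero character $\chi_X$ of $G$ whose irreducible constituents all lie in $X$ and which is constant on each part of $\mathcal{K}$; (c) $\{1\}\in\mathcal{K}$. The members of $\mathcal{K}$ are called the superclasses. Superclass theory: a partition $\mathcal{K}$ of $G$ satisfying one of the following two conditions,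 which are known to be equivalent: (1) $\mathcal{K}$ is the set of superclasses of a supercharacter theory of $G$; (2) $\{1\}\in\mathcal{K}$ and the $\mathbb{C}$-span of $\{\widehat{K}:K\in\mathcal{K}\}$ is a subring of the center $Z(\mathbb{C}[G])$ of the group algebra, where $\widehat{K}=\sum_{s\in K}s$. Normal superclass theory: for $\{N_1,\ldots,N_k\}\subseteq N(G)$, let $A=A(N_1,\ldots,N_k)$ be the smallest subset of $N(G)$ that contains $\{e\}$, $G$ and $N_1,\ldots,N_k$ and is closed under products $(H,K)\mapsto HK$ and intersections; for $N\in A$ let $N^{\circ}_{A}=N\setminus\bigcup_{K\in A,\ K<N}K$. A normal superclass theory of $G$ is a superclass theory of the form $\{N^{\circ}_{A}: N\in A,\ N^{\circ}_{A}\neq\emptyset\}$ for some such $\{N_1,\ldots,N_k\}$. A partition $\mathcal{P}$ of $G$ refines a partition $\mathcal{Q}$ of $G$ if every part of $\mathcal{P}$ is contained in a part of $\mathcal{Q}$. *)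

(* Defs.v *)
(* Characters are 'chi_i (i : Iirr G), so Irr(G) is indexed by Iirr G,
   with values in the algebraic complex numbers algC.  The group algebra is the
   matrix algebra group_ring algC G, spanned by the regular representation. *)
From mathcomp Require Import all_boot all_order all_fingroup all_algebra.
From mathcomp Require Import all_solvable all_field all_character.
From mathcomp Require Import finmap.

Set Implicit Arguments.
Unset Strict Implicit.
Unset Printing Implicit Defensive.

Import GroupScope GRing.Theory Num.Theory.
Local Open Scope ring_scope.

Definition central_idem (gT : finGroupType) (G : {group gT}) (i : Iirr G) :
    'M[algC]_#|G| :=
  (#|G|%:R^-1 * 'chi_i 1%g) *:
    \sum_(g in G) 'chi_i (g^-1)%g *: regular_repr algC G g.

Definition idem_set (gT : finGroupType) (G : {group gT}) (g : gT) :
    {fset 'M[algC]_#|G|} :=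
  [fset central_idem i | i in [set i : Iirr G | 1 - 'chi_i g / 'chi_i 1%g != 0]]%fset.

Definition idem_block (gT : finGroupType) (G : {group gT}) (g : gT) : {set gT} :=
  \bigcup_(h in G | idem_set G h == idem_set G g) (h ^: G)%g.

Definition normals (gT : finGroupType) (G : {group gT}) : {set {set gT}} :=
  [set N : {set gT} | group_set N & (N <| G)%g].

(* N° is strict_part (normals G) N. *)
Definition strict_part (gT : finGroupType) (A : {set {set gT}}) (N : {set gT}) :
    {set gT} :=
  N :\: \bigcup_(K in A | K \proper N) K.

Definition strict_parts (gT : finGroupType) (A : {set {set gT}}) :
    {set {set gT}} :=
  [set strict_part A N | N in A & strict_part A N != set0].

(* (H * K)%g is the setwise product. *)
Definition prod_cap_closed (gT : finGroupType) (S : {set {set gT}}) : bool :=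
  [forall H in S, forall K in S, ((H * K)%g \in S) && (H :&: K \in S)].

Definition normal_closed_family (gT : finGroupType) (G : {group gT})
    (Ns : {set {set gT}}) : {set {set gT}} :=
  \bigcap_(S : {set {set gT}} |
    [&& S \subset normals G, [set 1%g] \in S, (G : {set gT}) \in S,
        Ns \subset S & prod_cap_closed S]) S.

Definition supercharacter_theory (gT : finGroupType) (G : {group gT})
    (X : {set {set Iirr G}}) (P : {set {set gT}}) : Prop :=
  [/\ partition X [set: Iirr G], partition P G, #|X| = #|P|,
      (forall Y, Y \in X -> exists phi : 'CF(G),
         [/\ phi \is a character, phi != 0, {subset irr_constt phi <= Y} &
             forall B, B \in P -> {in B &, forall x y, phi x = phi y}])
    & [set 1%g] \in P].

Definition class_sum_span (gT : finGroupType) (G : {group gT})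
    (P : {set {set gT}}) :=
  (\sum_(B in P) <<mxvec (gset_mx algC G B)>>)%MS.

Definition spans_central_subring (gT : finGroupType) (G : {group gT})
    (P : {set {set gT}}) : Prop :=
  let S := class_sum_span G P in
  [/\ (S <= 'Z(group_ring algC G))%MS, (1%:M \in S)%MS & (S * S <= S)%MS].

(* The two alternatives are known to be equivalent for a partition of G
   (Diaconis-Isaacs). *)
Definition superclass_theory (gT : finGroupType) (G : {group gT})
    (P : {set {set gT}}) : Prop :=
  partition P G /\
  ((exists X : {set {set Iirr G}}, supercharacter_theory X P) \/
   ([set 1%g] \in P /\ spans_central_subring G P)).

Definition normal_superclass_theory (gT : finGroupType) (G : {group gT})
    (P : {set {set gT}}) : Prop :=
  superclass_theory G P /\
  exists2 Ns : {set {set gT}}, Ns \subset normals G &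
    P = strict_parts (normal_closed_family G Ns).

Definition refines (gT : finGroupType) (P Q : {set {set gT}}) : Prop :=
  forall B, B \in P -> exists2 C, C \in Q & B \subset C.

(* Main.v *)
Require Import Defs.
From mathcomp Require Import all_boot all_order all_fingroup all_algebra.
From mathcomp Require Import all_solvable all_field all_character.
From mathcomp Require Import finmap.

Set Implicit Arguments.
Unset Strict Implicit.
Unset Printing Implicit Defensive.

(** For [g] in [G] let [<<g ^: G>>] denote its normal closure.  Everything is
    controlled by the map sending [g] to its normal closure: both families of
    sets in the first claim are the fibres of this map.

    - An element of a normal subgroup [N] lies in the strict part of [N] exactly
      when it lies in no smaller normal subgroup, that is, when its normal
      closure is [N] ([mem_strict_part], [strict_partsE]).
    - The central idempotents are pairwise distinct, so the idempotent set of
      [g] records the irreducible characters whose kernel does not contain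
      [g].  A kernel contains [g] iff it contains the normal closure of [g],
      and every normal subgroup is the intersection of the kernels containing
      it; hence two elements have the same idempotent set iff they have the
      same normal closure ([idem_set_eq], [idem_blockE]).

    The fibres form a superclass theory by the group algebra criterion.  The sum
    of a normal subgroup is the sum of the parts it contains, and by induction
    on the order this relation can be inverted, so the parts and the normal
    subgroups span the same space ([span_strict_parts]).  This space is a
    central subring because the sum of [H] times the sum of [K] is
    [#|H :&: K|] times the sum of [H * K] ([gset_mx_mul]).

    Finally, let [S] be any family of normal subgroups containing [G].  Each
    fibre lies in one strict part relative to [S]: if [M] is a member of [S] of
    least order containing [g], then every element with the same normal closure
    as [g] lies in the same members of [S] as [g], hence in the strict part of
    [M] relative to [S] ([strict_parts_refines]). *)

Section NormalClosureFibres.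

Import GroupScope GRing.Theory Num.Theory.
Local Open Scope ring_scope.

Variables (gT : finGroupType) (G : {group gT}).
Implicit Types (g h x : gT) (N K H A B : {set gT}).
Implicit Type Ns : {set {set gT}}.

(** * Normal closures and strict parts *)

(** The normal closure of [g] in [G], as a group. *)
Local Notation nclose g := <<(g ^: G)%g>>%G.

Lemma in_normals (N : {group gT}) : (gval N \in normals G) = (N <| G)%g.
Proof. by rewrite inE groupP. Qed.

Lemma normalsP {N} : N \in normals G ->
  exists2 M : {group gT}, N = M & (M <| G)%g.
Proof. by rewrite inE => /andP[gN nN]; exists (Group gN). Qed.

Lemma nclose_normal g : g \in G -> (nclose g <| G)%g.
Proof.
move=> Gg; apply/andP; split; first by rewrite gen_subG class_subG.
by rewrite norms_gen ?class_norm.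
Qed.

Lemma mem_nclose g : g \in nclose g.
Proof. by rewrite mem_gen ?class_refl. Qed.

Lemma nclose_sub g (N : {group gT}) : (N <| G)%g ->
  (nclose g \subset N) = (g \in N).
Proof.
case/andP=> _ nNG; apply/idP/idP=> [/subsetP-> //|Ng]; first exact: mem_nclose.
by rewrite gen_subG class_sub_norm.
Qed.

Lemma strict_part_sub (S : {set {set gT}}) N : strict_part S N \subset N.
Proof. exact: subsetDl. Qed.

(** For [N] normal, the strict part of [N] consists of the elements of [G] whose
    normal closure is [N]. *)
Lemma mem_strict_part N g : N \in normals G ->
  (g \in strict_part (normals G) N) = (g \in G) && (<<(g ^: G)%g>> == N).
Proof.
case/normalsP=> M -> nM; have sMG := normal_sub nM.
apply/setDP/andP=> [[Mg notK]|[Gg /eqP defM]].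
  have Gg := subsetP sMG g Mg; split=> //.
  have sgM: nclose g \subset M by rewrite nclose_sub.
  apply: contraR notK => neq; apply/bigcupP; exists (gval (nclose g)).
    by rewrite in_normals nclose_normal // properEneq neq.
  exact: mem_nclose.
rewrite -defM mem_nclose; split=> //.
apply/bigcupP=> -[_ /andP[/normalsP[K -> nK]]].
by rewrite properE => /andP[_ /negP]; rewrite nclose_sub.
Qed.

Lemma strict_partsE :
  strict_parts (normals G) = preim_partition (fun g => <<(g ^: G)%g>>) G.
Proof.
apply/setP=> B.
apply/imsetP/imsetP=> [[N /[!inE] /andP[nN /set0Pn[g Ng]] ->]|[g Gg ->]].
  have:= Ng; rewrite mem_strict_part ?inE // => /andP[Gg /eqP defN].
  exists g => //; apply/setP=> h.
  by rewrite mem_strict_part ?inE // -defN eq_sym.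
have nN: <<(g ^: G)%g>> \in normals G by rewrite in_normals nclose_normal.
have defB: [set h in G | <<(g ^: G)%g>> == <<(h ^: G)%g>>]
         = strict_part (normals G) <<(g ^: G)%g>>.
  by apply/setP=> h; rewrite mem_strict_part // inE eq_sym.
exists <<(g ^: G)%g>>; last exact: defB.
rewrite inE nN -defB; apply/set0Pn; exists g.
by rewrite inE Gg eqxx.
Qed.

Lemma strict_parts_partition : partition (strict_parts (normals G)) G.
Proof. by rewrite strict_partsE preim_partitionP. Qed.

(** * Idempotent sets *)

(** Extending ['chi_i] linearly to the group algebra separates the central
    idempotents. *)
Lemma xcfun_central_idem (i j : Iirr G) :
  xcfun 'chi_i (central_idem j) = 'chi_i 1%g *+ (i == j).
Proof.
rewrite -xcfun_id Wedderburn_id_expansion /central_idem -scalerA.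
congr (xcfun _ (_ *: _)); rewrite scaler_sumr.
by apply: eq_bigr => x _; rewrite scalerA.
Qed.

Lemma central_idem_inj : injective (@central_idem gT G).
Proof.
move=> i j /(congr1 (xcfun 'chi_i)); rewrite !xcfun_central_idem eqxx.
by case: eqP => // _ /eqP; rewrite (negPf (irr1_neq0 i)).
Qed.

Lemma mem_idem_set (i : Iirr G) g :
  (central_idem i \in idem_set G g) = (g \notin cfker 'chi_i).
Proof.
rewrite /idem_set mem_imfset /=; last exact: central_idem_inj.
rewrite [LHS]inE cfkerEirr inE subr_eq0 eq_sym.
by rewrite -(inj_eq (mulIf (irr1_neq0 i))) divfK ?irr1_neq0 // mul1r.
Qed.

Lemma idem_set_eq g h : g \in G -> h \in G ->
  (idem_set G h == idem_set G g) = (<<(h ^: G)%g>> == <<(g ^: G)%g>>).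
Proof.
move=> Gg Gh; apply/eqP/eqP=> [eqE|eqN].
  have eq_ker (i : Iirr G) : (h \in cfker 'chi_i) = (g \in cfker 'chi_i).
    by apply: negb_inj; rewrite -!mem_idem_set eqE.
  rewrite -(cap_cfker_normal (nclose_normal Gh)).
  rewrite -(cap_cfker_normal (nclose_normal Gg)).
  by apply: eq_bigl => i; rewrite !nclose_sub ?cfker_normal /= ?eq_ker.
have eq_ker (i : Iirr G) : (h \in cfker 'chi_i) = (g \in cfker 'chi_i).
  by rewrite -!nclose_sub ?cfker_normal //= eqN.
have sub x y :
    (forall i : Iirr G, (x \in cfker 'chi_i) = (y \in cfker 'chi_i)) ->
    {subset idem_set G x <= idem_set G y}.
  move=> exy A EA; have /imfsetP[i _ defA] := EA.
  by move: EA; rewrite defA !mem_idem_set exy.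
by apply/fsetP=> A; apply/idP/idP; apply: sub => // i; rewrite eq_ker.
Qed.

Lemma idem_blockE g : g \in G ->
  idem_block G g = [set h in G | <<(g ^: G)%g>> == <<(h ^: G)%g>>].
Proof.
move=> Gg; apply/setP=> x; rewrite inE; apply/bigcupP/andP.
  case=> h /andP[Gh]; rewrite idem_set_eq // => /eqP eqN hGx.
  split; first exact: subsetP (class_subG Gh (subxx G)) _ hGx.
  by rewrite -eqN; case/imsetP: hGx => y Gy ->; rewrite classGidl.
case=> Gx eqN; exists x; last exact: class_refl.
by rewrite Gx idem_set_eq // eq_sym.
Qed.

Lemma idem_blocksE : [set idem_block G g | g in G] = strict_parts (normals G).
Proof.
by rewrite strict_partsE; apply: eq_in_imset => g Gg; apply: idem_blockE.
Qed.

(** * Sums of normal subgroups in the group algebra *)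

Local Notation gsum := (gset_mx algC G).
Local Notation P := (strict_parts (normals G)).

Lemma gset_mx_cent (N : {group gT}) :
  (N <| G)%g -> (gsum N \in 'Z(group_ring algC G))%MS.
Proof.
case/andP=> sNG nNG; have subG := subsetP sNG.
rewrite sub_capmx; apply/andP; split.
  by rewrite linear_sum summx_sub // => x Nx; rewrite envelop_mx_id ?subG.
rewrite memmx_cent_envelop; apply/centgmxP=> y Gy.
rewrite {2}/gset_mx (reindex_acts 'J _ Gy) ?astabsJ //=.
rewrite mulmx_suml mulmx_sumr; apply: eq_bigr => z /subG Gz.
by rewrite -!repr_mxM ?groupJ // -conjgC.
Qed.

(** If [x = h * k] then the factorisations of [x] are the pairs
    [(h * d, d^-1 * k)] with [d] in [H :&: K]. *)
Lemma card_mul_fibre (H K : {group gT}) x : x \in (H * K)%g ->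
  #|[set p in setX H K | (p.1 * p.2)%g == x]| = #|H :&: K|.
Proof.
case/mulsgP=> h k Hh Kk defx.
rewrite -(card_imset _ (_ : injective (fun d : gT => (h * d, d^-1 * k)%g))).
  apply: eq_card => -[a b]; rewrite !inE /=; apply/andP/imsetP.
    case=> /andP[Ha Kb] /eqP eqx; exists (h^-1 * a)%g.
      rewrite inE groupM ?groupV //=.
      have -> : (h^-1 * a = k * b^-1)%g.
        by apply: (mulgI h); rewrite mulKVg mulgA -defx -eqx mulgK.
      by rewrite groupM ?groupV.
    by rewrite mulKVg invMg invgK -mulgA -defx -eqx mulKg.
  case=> d /setIP[Hd Kd] [-> ->].
  by rewrite !groupM ?groupV // -mulgA mulKVg defx.
by move=> d1 d2 [/mulgI].
Qed.

Lemma gset_mx_mul (H K : {group gT}) : H \subset G -> K \subset G ->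
  gsum H *m gsum K = #|H :&: K|%:R *: gsum (H * K)%g.
Proof.
move=> /subsetP sHG /subsetP sKG.
rewrite mulmx_suml.
under eq_bigr do rewrite mulmx_sumr.
rewrite pair_big_dep /=.
rewrite (partition_big (fun p => p.1 * p.2)%g (mem (H * K)%g)) /=; last first.
  by case=> h k /andP[/= Hh Kk]; rewrite mem_mulg.
rewrite scaler_sumr; apply: eq_bigr => x HKx.
rewrite -(card_mul_fibre HKx) scaler_nat -sumr_const.
apply: eq_big => [[h k]|[h k] /andP[/andP[/= Hh Kk] /eqP <-]].
  by rewrite !inE.
by rewrite repr_mxM; [| exact: sHG | exact: sKG].
Qed.

Lemma gset_mx_in_span (Q : {set {set gT}}) B :
  B \in Q -> (gsum B \in class_sum_span G Q)%MS.
Proof. by move=> QB; apply: (sumsmx_sup B) => //; rewrite genmxE. Qed.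

Lemma gset_mx_normal N : N \in normals G ->
  gsum N = \sum_(B in [set B in P | B \subset N]) gsum B.
Proof.
move=> nN; set Q := [set B in P | B \subset N].
have sQP : Q \subset P by apply/subsetP=> B /setIdP[].
have /and3P[_ tiP _] := strict_parts_partition.
rewrite -(big_trivIset _ (trivIsetS sQP tiP)) /=; apply: eq_bigl => x.
apply/idP/bigcupP=> [Nx|[B /setIdP[_ /subsetP]]]; last exact.
have [M defN nM] := normalsP nN; have Gx : x \in G.
  by apply: (subsetP (normal_sub nM)); rewrite -defN.
have nX : <<(x ^: G)%g>> \in normals G by rewrite in_normals nclose_normal.
have Bx : x \in strict_part (normals G) <<(x ^: G)%g>>.
  by rewrite mem_strict_part // Gx /=.
exists (strict_part (normals G) <<(x ^: G)%g>>) => //.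
rewrite !inE; apply/andP; split.
  apply/imsetP; exists <<(x ^: G)%g>> => //.
  by rewrite inE nX; apply/set0Pn; exists x.
by rewrite (subset_trans (strict_part_sub _ _)) // defN nclose_sub // -defN.
Qed.

Lemma span_strict_parts :
  (class_sum_span G P :=: class_sum_span G (normals G))%MS.
Proof.
apply/eqmxP/andP; split; apply/sumsmx_subP=> B PB; rewrite genmxE; last first.
  rewrite gset_mx_normal // linear_sum summx_sub // => C /setIdP[PC _].
  exact: gset_mx_in_span.
case/imsetP: PB => N /setIdP[nN _] ->{B}.
(* Induction on the order: the strict part of [N] is [N] minus the parts
   belonging to normal subgroups properly contained in [N]. *)
have [n] := ubnP #|N|; elim: n N nN => // n IHn N nN ltn.
have [->|nzN] := eqVneq (strict_part (normals G) N) set0.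
  by rewrite /gset_mx big_set0 linear0 sub0mx.
have PN : strict_part (normals G) N \in [set B in P | B \subset N].
  by rewrite inE strict_part_sub andbT imset_f // inE nN.
have := gset_mx_normal nN.
rewrite (bigD1 _ PN) /= => /(canLR (addrK _)) <-.
rewrite linearB addmx_sub ?eqmx_opp ?gset_mx_in_span //.
rewrite linear_sum summx_sub // => B /andP[/setIdP[/imsetP[K]]].
case/setIdP=> nK /set0Pn[x Kx] -> sKN neqB; apply: IHn => //.
have [M defN nM] := normalsP nN.
rewrite -ltnS (leq_trans _ ltn) // ltnS proper_card // properEneq.
apply/andP; split; first by apply: contraNneq neqB => ->.
move: (Kx); rewrite mem_strict_part // => /andP[Gx /eqP <-].
by rewrite defN nclose_sub // -defN (subsetP sKN).
Qed.

(** * Superclass theory and refinement *)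

Lemma normals_prod_cap_closed : prod_cap_closed (normals G).
Proof.
apply/forall_inP=> _ /normalsP[H -> nH].
apply/forall_inP=> _ /normalsP[K -> nK].
rewrite (in_normals (H :&: K)) normalI //.
rewrite -norm_joinEl; first by rewrite in_normals normalY.
by rewrite (subset_trans (normal_sub nH)) ?normal_norm.
Qed.

(** The partition satisfies the group algebra criterion: the identity
    forms a part by itself, and the sums of the parts span a central subring. *)
Lemma strict_parts_superclass : superclass_theory G P.
Proof.
split; first exact: strict_parts_partition; right; split.
  rewrite strict_partsE; apply/imsetP; exists 1%g => //; apply/setP=> h.
  rewrite !inE class1G genGid; apply/eqP/andP=> [->|[Gh]].
    by rewrite class1G genGid eqxx.
  move=> /eqP eqh; apply/set1P; rewrite eqh; exact: mem_nclose.
have sub M : M \in normals G -> (gsum M \in class_sum_span G P)%MS.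
  by move=> nM; rewrite span_strict_parts gset_mx_in_span.
split.
- rewrite span_strict_parts; apply/sumsmx_subP=> _ /normalsP[M -> nM].
  by rewrite genmxE gset_mx_cent.
- have := sub 1%g; rewrite (in_normals 1%G) normal1 /gset_mx big_set1 repr_mx1.
  exact.
rewrite (muls_eqmx span_strict_parts span_strict_parts) span_strict_parts.
apply/mulsmx_subP=> A1 A2 /memmx_sumsP[B1 -> sB1] /memmx_sumsP[B2 -> sB2].
rewrite mulmx_suml linear_sum summx_sub // => N1 nN1.
rewrite mulmx_sumr linear_sum summx_sub // => N2 nN2.
have:= sB1 N1; rewrite genmxE => /sub_rVP[a].
rewrite -linearZ => /(can_inj mxvecK)->.
have:= sB2 N2; rewrite genmxE => /sub_rVP[b].
rewrite -linearZ => /(can_inj mxvecK)->.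
rewrite -scalemxAl -scalemxAr !linearZ !scalemx_sub //.
have nN := forall_inP (forall_inP normals_prod_cap_closed _ nN1) _ nN2.
have [[M1 defN1 nM1] [M2 defN2 nM2]] := (normalsP nN1, normalsP nN2).
rewrite defN1 defN2 gset_mx_mul ?normal_sub // linearZ scalemx_sub //.
by rewrite gset_mx_in_span // -defN1 -defN2; case/andP: nN.
Qed.

Lemma normal_closed_familyS Ns : Ns \subset normals G ->
  normal_closed_family G Ns \subset normals G.
Proof.
move=> sNs; apply: bigcap_inf; rewrite sNs subxx normals_prod_cap_closed.
by rewrite (in_normals 1%G) (in_normals G) normal1 normal_refl.
Qed.

Lemma normal_closed_family_normals :
  normal_closed_family G (normals G) = normals G.
Proof.
apply/eqP; rewrite eqEsubset normal_closed_familyS //=.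
by apply/bigcapsP=> S /and5P[].
Qed.

Lemma group_in_normal_closed_family Ns : gval G \in normal_closed_family G Ns.
Proof. by apply/bigcapP=> S /and5P[]. Qed.

(** Neither products nor intersections are needed in [S]; that [G] is in [S]
    ensures that every element of [G] lies in some member of [S]. *)
Lemma strict_parts_refines (S : {set {set gT}}) :
  S \subset normals G -> gval G \in S -> refines P (strict_parts S).
Proof.
move=> /subsetP sS SG _ /imsetP[N /setIdP[nN /set0Pn[g Ng]] ->].
have:= Ng; rewrite mem_strict_part // => /andP[Gg /eqP defN].
have [] := @arg_minnP _ (gval G) (fun M => (M \in S) && (g \in M))
                      (fun M => #|M|).
  by rewrite SG.
move=> M /andP[SM Mg] minM.
have sub: strict_part (normals G) N \subset strict_part S M.
  apply/subsetP=> h; rewrite mem_strict_part // -defN => /andP[Gh /eqP eqN].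
  have same K : K \in S -> (h \in K) = (g \in K).
    by move=> /sS/normalsP[L -> nL]; rewrite -!nclose_sub //= eqN.
  rewrite inE (same M SM) Mg andbT; apply/bigcupP=> -[K /andP[SK ltKM]].
  rewrite same // => Kg; have:= minM K; rewrite SK Kg => /(_ isT).
  by rewrite leqNgt proper_card.
exists (strict_part S M) => //; apply/imsetP; exists M => //.
by rewrite inE SM; apply/set0Pn; exists g; apply: subsetP sub _ Ng.
Qed.

End NormalClosureFibres.

Theorem corollary3p7 (gT : finGroupType) (G : {group gT}) :
  [/\ [set idem_block G g | g in G] = strict_parts (normals G),
      normal_superclass_theory G (strict_parts (normals G))
    & forall Q : {set {set gT}}, normal_superclass_theory G Q ->
        refines (strict_parts (normals G)) Q].
Proof.
split; first exact: idem_blocksE.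
  split; first exact: strict_parts_superclass.
  by exists (normals G); rewrite ?normal_closed_family_normals.
move=> _ [_ [Ns sNs ->]]; apply: strict_parts_refines.
  exact: normal_closed_familyS.
exact: group_in_normal_closed_family.
Qed.
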